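(* Let $\mathcal{E},\mathcal{E}'$ be symmetric subsets of $S(n)$, let $\mathcal{K},\mathcal{K}'$ be symmetric convex bodies in $S(n)$, and let $\alpha,\beta\in\mathbb{R}$. Then: 1. $\operatorname{ext}\mathcal{K}$ is a symmetric subset of $S(n)$. 2. $\operatorname{ext}\Phi(\mathcal{K})=\Phi(\operatorname{ext}\mathcal{K})$. 3. $\alpha\mathcal{E}+\beta\mathcal{E}'$ is a symmetric subset of $S(n)$, and $\alpha\mathcal{K}+\beta\mathcal{K}'$ is a symmetric convex body in $S(n)$. 4. $\Phi(\alpha\{I\}+\beta\mathcal{E})=\alpha\{\mathbf{1}\}+\beta\Phi(\mathcal{E})$ and $\Phi(\alpha\mathcal{K}+\beta\mathcal{K}')=\alpha\Phi(\mathcal{K})+\beta\Phi(\mathcal{K}')$. 5. $\mathcal{E}'\subseteq\mathcal{E}$ implies $\Phi(\mathcal{E}')\subseteq\Phi(\mathcal{E})$. Furthermore, the corresponding claims hold for symmetric subsets $\varepsilon,\varepsilon'$ of $\mathbb{R}^n$, symmetric convex bodies $\kappa,\kappa'$ in $\mathbb{R}^n$, and $\Phi^{-1}$; that is: $\operatorname{ext}\kappa$ is symmetric; $\operatorname{ext}\Phi^{-1}(\kappa)=\Phi^{-1}(\operatorname{ext}\kappa)$; $\alpha\varepsilon+\beta\varepsilon'$ is a symmetric subset of $\mathbb{R}^n$ and $\alpha\kappa+\beta\kappa'$ is a symmetric convex body in $\mathbb{R}^n$; $\Phi^{-1}(\alpha\{\mathbf{1}\}+\beta\varepsilon)=\alpha\{I\}+\beta\Phi^{-1}(\varepsilon)$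 and $\Phi^{-1}(\alpha\kappa+\beta\kappa')=\alpha\Phi^{-1}(\kappa)+\beta\Phi^{-1}(\kappa')$; and $\varepsilon'\subseteq\varepsilon$ implies $\Phi^{-1}(\varepsilon')\subseteq\Phi^{-1}(\varepsilon)$.
   Context: Here $n\geq 2$. $S(n)$ is the space of symmetric real $n\times n$ matrices, $I$ the identity matrix, $\mathbf{1}:=(1,\dots,1)^T\in\mathbb{R}^n$; $O(n)$ is the set of orthogonal $n\times n$ matrices; $\mathcal{P}(n)\subseteq O(n)$ is the set of permutation matrices. For $Y\in S(n)$, $\overline{\lambda}(Y)\in\mathbb{R}^n$ is the vector of eigenvalues of $Y$ (with multiplicity) in increasing order. For $y\in\mathbb{R}^n$, $\operatorname{diag}y\in S(n)$ is the diagonal matrix with diagonal entries $y_1,\dots,y_n$. A subset $\mathcal{E}\subseteq S(n)$ is symmetric if $\mathcal{E}=\{Q^TYQ\;|\;Y\in\mathcal{E}\}$ for all $Q\in O(n)$. A subset $\varepsilon\subseteq\mathbb{R}^n$ is symmetric if $\varepsilon=\{Py\;|\;y\in\varepsilon\}$ for all $P\in\mathcal{P}(n)$. A convex body is a nonempty, convex and compact subset. A point $E$ of a convex body $\mathcal{K}$ is an extreme point if $\mathcal{K}\setminus\{E\}$ is convex; $\operatorname{ext}\mathcal{K}$ is the set of extreme points. Sums and scalings of sets are in the Minkowski sense: $A+B=\{a+b\;|\;a\in A,b\in B\}$, $cA=\{ca\;|\;a\in A\}$. The map $\Phi(\mathcal{E}):=\{P\overline{\lambda}(Y)\;|\;P\in\mathcal{P}(n),\,Y\in\mathcal{E}\}$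 is a bijection from the symmetric subsets of $S(n)$ to the symmetric subsets of $\mathbb{R}^n$, with inverse $\Phi^{-1}(\varepsilon)=\{Q(\operatorname{diag}y)Q^T\;|\;Q\in O(n),\,y\in\varepsilon\}$. *)

(* Defs.v *)
From HB Require Import structures.
From mathcomp Require Import all_boot all_order all_algebra.
From mathcomp Require Import sesquilinear spectral.
From mathcomp Require Import all_classical all_reals all_analysis.
From mathcomp Require Import polyrcf complex.
Set Implicit Arguments.
Unset Strict Implicit.
Unset Printing Implicit Defensive.
Import Order.TTheory GRing.Theory Num.Theory.
Import numFieldNormedType.Exports.
Local Open Scope classical_set_scope.
Local Open Scope ring_scope.

Section Sets.
Context {R : realType} {V : normedModType R}.

Definition convex_body (K : set V) : Prop :=
  [/\ K !=set0, convex_set K & compact K].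

Definition extreme_points (K : set V) : set V :=
  [set x | K x /\ convex_set (K `\ x)].

Definition minkowski_sum (A B : set V) : set V := [set a + b | a in A & b in B].

Definition minkowski_scale (c : R) (A : set V) : set V := [set c *: a | a in A].

End Sets.

Notation "A [+] B" := (minkowski_sum A B) (at level 50, left associativity).
Notation "c [*] A" := (minkowski_scale c A) (at level 40, left associativity).

Section Matrices.
Context {R : realType} {n : nat}.

Definition sym_mx : set 'M[R]_n := [set Y | Y^T = Y].

Definition orthogonal_mx : set 'M[R]_n := [set Q | Q^T *m Q = 1%:M].

Definition permutation_mx : set 'M[R]_n := [set P | is_perm_mx P].

(* rootsR lists the distinct real roots in increasing order; each one is repeated
   according to its algebraic multiplicity. *)
Definition eigenvalue_seq (Y : 'M[R]_n) : seq R :=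
  flatten [seq nseq (mup a (char_poly Y)) a | a <- rootsR (char_poly Y)].

Definition lambda_bar (Y : 'M[R]_n) : 'cV[R]_n :=
  \col_(i < n) (eigenvalue_seq Y)`_i.

Definition symmetric_mx_set (E : set 'M[R]_n) : Prop :=
  E `<=` sym_mx /\
  forall Q, orthogonal_mx Q -> E = [set Q^T *m Y *m Q | Y in E].

Definition symmetric_cV_set (e : set 'cV[R]_n) : Prop :=
  forall P, permutation_mx P -> e = [set P *m y | y in e].

Definition Phi (E : set 'M[R]_n) : set 'cV[R]_n :=
  [set P *m lambda_bar Y | P in permutation_mx & Y in E].

(* diag_mx takes a row vector, hence the transpose on y. *)
Definition Phi_inv (e : set 'cV[R]_n) : set 'M[R]_n :=
  [set Q *m diag_mx y^T *m Q^T | Q in orthogonal_mx & y in e].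

End Matrices.

Lemma char_poly_sym_split (R : realType) n (Y : 'M[R]_n) : sym_mx Y ->
  exists s : seq R, char_poly Y = \prod_(a <- s) ('X - a%:P).
Proof.
move=> symY.
pose f := real_complex R.
pose Z := map_mx f Y.
have Zr : Z \is a realmx.
  by apply/mxOverP=> i j; rewrite mxE; apply/complex_realP; exists (Y i j).
have Zs : Z \is symmetricmx.
  apply/is_hermitianmxP; rewrite expr0 scale1r map_mx_id//.
  by rewrite map_trmx symY.
have Zh := realsym_hermsym Zs Zr.
have /orthomx_spectralP ZE := hermitian_normalmx Zh.
have dr := hermitian_spectral_diag_real Zh.
have Pu := spectral_unit Z.
move: ZE dr Pu; set P := spectralmx Z; set d := spectral_diag Z => ZE dr Pu.
have cZ : char_poly Z = char_poly (diag_mx d).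
  rewrite /char_poly /char_poly_mx.
  have -> : 'X%:M - map_mx polyC Z =
     map_mx polyC (invmx P) *m ('X%:M - map_mx polyC (diag_mx d)) *m map_mx polyC P.
    rewrite mulmxBr mulmxBl -!map_mxM -ZE; congr (_ - _).
    by rewrite mul_mx_scalar -scalemxAl -map_mxM mulVmx// map_mx1 scalemx1.
  rewrite !det_mulmx mulrAC -det_mulmx -map_mxM mulVmx//.
  by rewrite map_mx1 det1 mul1r.
exists [seq complex.Re (d 0 i) | i <- enum 'I_n].
apply: (map_inj_poly (f := f)) => //; first by move=> x y [].
rewrite map_char_poly -/Z cZ char_poly_trig; last exact: diag_mx_is_trig.
rewrite rmorph_prod big_map big_enum /=; apply: eq_bigr => i _.
rewrite rmorphB /= map_polyX map_polyC /= mxE eqxx mulr1n.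
have /complex_realP [x ->] : d 0 i \is Num.real by exact: (mxOverP dr).
by [].
Qed.

(* For symmetric Y the sequence has exactly n entries, so the default value of
   nth in lambda_bar is never reached. *)
Lemma eigenvalue_seqP (R : realType) n (Y : 'M[R]_n) : sym_mx Y ->
  [/\ sorted <=%R (eigenvalue_seq Y), size (eigenvalue_seq Y) = n &
    char_poly Y = \prod_(a <- eigenvalue_seq Y) ('X - a%:P)].
Proof.
move=> /char_poly_sym_split [s ps].
have pn0 : char_poly Y != 0 by rewrite monic_neq0 ?char_poly_monic.
have mu a : mup a (char_poly Y) = count_mem a s by rewrite ps mu_prod_XsubC.
set r := rootsR (char_poly Y).
have memr a : (a \in r) = (a \in s).
  have := roots_on_rootsR pn0 a; rewrite in_itv/= => <-.
  by rewrite ps root_prod_XsubC.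
have pe : perm_eq s (eigenvalue_seq Y).
  apply/allP => a _ /=; rewrite /eigenvalue_seq count_flatten -map_comp.
  rewrite sumnE big_map -/r.
  under eq_bigr do rewrite /= count_nseq /= mu.
  have ur : uniq r by apply: (sorted_uniq lt_trans ltxx); exact: sorted_roots.
  have [ar|ar] := boolP (a \in r).
    rewrite (bigD1_seq a)//= eqxx mul1n big1 ?addn0// => b ba.
    by rewrite (negbTE ba).
  rewrite big1_seq => [|b /andP[_ br]].
    by rewrite (count_memPn _) // -memr.
  by case: eqP br ar => [->|//] ->.
split.
- rewrite /eigenvalue_seq -/r.
  have : sorted <%R r by exact: sorted_roots.
  elim: r {memr pe} => //= a r IH; rewrite (path_sortedE lt_trans) => /andP[ha hs].
  rewrite (sorted_pairwise le_trans) pairwise_cat -!(sorted_pairwise le_trans).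
  rewrite IH// andbT; apply/andP; split; last first.
    by case: (mup a _) => //= k; elim: k => //= k ->; rewrite lexx.
  apply/allrelP => x y /nseqP[-> _] /flatten_mapP[b br /nseqP[-> _]].
  exact/ltW/(allP ha).
- rewrite -(perm_size pe); have := size_char_poly Y.
  by rewrite ps size_prod_XsubC => -[].
- by rewrite ps; apply: perm_big.
Qed.

(* Main.v *)
Require Import Defs.
From mathcomp Require Import all_boot all_order all_algebra fingroup perm ring.
From mathcomp Require Import all_classical all_reals all_analysis.
Set Implicit Arguments.
Unset Strict Implicit.
Unset Printing Implicit Defensive.
Import Order.TTheory GRing.Theory Num.Theory.
Import numFieldNormedType.Exports.
Local Open Scope classical_set_scope.
Local Open Scope ring_scope.

(* By the spectral theorem, [Phi E] and [Phi_inv e] are determined by which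
   diagonal matrices lie in [E], and Phi and Phi_inv are mutually inverse, so the
   matrix claims are transported from the vector claims. The latter rest on
   Schur's theorem: the diagonal of Q (diag y) Q^T is (Q i j ^ 2) y with
   (Q i j ^ 2) doubly stochastic, so by Birkhoff's theorem it belongs to every
   convex set containing all permutations of y. Diagonalising a combination
   a A + b B and reading off diagonals shows that its spectrum is a u + b v with
   u in k and v in k'. For extreme points one adds that a symmetric matrix whose
   diagonal has the Frobenius norm of its spectrum is diagonal. *)

(** * Hall's marriage theorem *)

Section Hall.
Context {T U : finType} (r : T -> U -> bool).

Definition nbrs (V : {set U}) (B : {set T}) : {set U} :=
  [set u in V | [exists t in B, r t u]].

(** Induction on the size of [A]. If a nonempty proper subset [B] is tight, with exactly as many
    neighbours as elements, then [B] is matched into them and [A :\: B] into the remaining targets;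
    otherwise any edge at a chosen [a] can be removed. [V] is a parameter because both cases shrink
    the set of targets; [u0] supplies the value of [f] when [A] is empty. *)
Lemma hall_in (u0 : U) (A : {set T}) (V : {set U}) :
  (forall B : {set T}, B \subset A -> (#|B| <= #|nbrs V B|)%N) ->
  exists f : T -> U,
    {in A &, injective f} /\ forall t, t \in A -> f t \in V /\ r t (f t).
Proof.
have [m] := ubnP #|A|; elim: m A V => // m IH A V; rewrite ltnS => Am hall.
have [->|[a aA]] := finset.set_0Vmem A.
  by exists (fun=> u0); split => [x y|x]; rewrite inE.
have [/existsP[B /and3P[/andP[BA B0] nAB /eqP tight]]|loose] := boolP
    [exists B : {set T}, [&& (B \subset A) && (B != finset.set0), ~~ (A \subset B)
      & #|nbrs V B| == #|B|]].
  have BpA : B \proper A by rewrite properE BA.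
  have [f [finj fV]] := IH B V (leq_trans (proper_card BpA) Am)
    (fun C CB => hall C (fintype.subset_trans CB BA)).
  have [||g [ginj gV]] := IH (A :\: B) (V :\: nbrs V B).
  - rewrite (leq_trans _ Am)// cardsD (finset.setIidPr BA) ltn_subrL.
    by rewrite !card_gt0 B0; apply/set0Pn; exists a.
  - move=> C CAB.
    (* Hall's condition for [C] away from the neighbours of [B] is the condition for [B :|: C] with
       the equality for [B] subtracted. *)
    have := hall (B :|: C); rewrite finset.subUset BA.
    rewrite (fintype.subset_trans CAB) ?finset.subsetDl// => /(_ isT).
    have /finset.setIidPl CB : C \subset ~: B.
      by apply: fintype.subset_trans CAB _; rewrite finset.setDE finset.subsetIr.
    have BC0 : B :&: C = finset.set0.
      by rewrite -CB finset.setICA finset.setICr finset.setI0.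
    rewrite cardsU BC0 cards0 subn0 -tight => le.
    rewrite -(leq_add2l #|nbrs V B|); apply: leq_trans le _.
    apply: leq_trans (leq_card_setU _ _); apply/subset_leq_card/fintype.subsetP => u.
    rewrite !inE => /andP[uV /existsP[t /andP[+ rtu]]]; rewrite !inE uV andbT /=.
    have [//|/existsPn/(_ t)] := boolP [exists t in B, r t u].
    by rewrite rtu andbT => /negbTE -> /= tC; apply/existsP; exists t; rewrite tC.
  exists (fun t => if t \in B then f t else g t); split => [x y xA yA|t tA].
    have sep z w : z \in B -> w \in A -> w \notin B -> f z != g w.
      move=> zB wA wB; have [fzV rz] := fV _ zB; have [|] := gV w.
        by rewrite inE wB.
      rewrite inE => /andP[+ _] _; apply: contraNneq => <-.
      by rewrite inE fzV /=; apply/existsP; exists z; rewrite zB.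
    case: ifPn => xB; case: ifPn => yB.
    - exact: finj.
    - by move/eqP; rewrite (negbTE (sep _ _ xB yA yB)).
    - by move/eqP; rewrite eq_sym (negbTE (sep _ _ yB xA xB)).
    - by apply: ginj; rewrite inE ?xB ?yB.
  case: ifPn => tB; first exact: fV.
  by have [|] := gV t; [rewrite inE tB|rewrite inE => /andP[_ ? ?]].
(* No nonempty proper subset is tight, so each has a spare neighbour and deleting [u] preserves
   Hall's condition. *)
have /card_gt0P[u] : (0 < #|nbrs V [set a]|)%N.
  by apply: leq_trans (hall _ _); rewrite ?cards1// finset.sub1set.
rewrite inE => /andP[uV /existsP[a' /andP[]]]; rewrite inE => /eqP -> rau.
have [||f [finj fV]] := IH (A :\ a) (V :\ u).
- by rewrite (leq_trans _ Am)// [in leqRHS](cardsD1 a) aA.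
- move=> B BAa; have [->|B0] := eqVneq B finset.set0; first by rewrite cards0.
  have BA : B \subset A by rewrite (fintype.subset_trans BAa) ?finset.subsetDl.
  have : (#|B| < #|nbrs V B|)%N.
    rewrite ltn_neqAle hall// andbT eq_sym; apply: contra loose => tight.
    apply/existsP; exists B; rewrite BA B0 tight !andbT /=.
    apply/negP => AB; have aB := fintype.subsetP AB a aA.
    by have := fintype.subsetP BAa a aB; rewrite !inE eqxx.
  rewrite (cardsD1 u) => lt; have : (#|B| <= #|nbrs V B :\ u|)%N.
    by move: lt; case: (u \in _); rewrite ?add1n ?add0n// => /ltnW.
  move/leq_trans; apply; apply/subset_leq_card/fintype.subsetP => v.
  by rewrite !inE => /and3P[-> -> ->].
exists (fun t => if t == a then u else f t); split => [x y xA yA|t tA].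
  have sep w : w \in A -> w != a -> f w != u.
    by move=> wA wa; have [|] := fV w; rewrite !inE ?wa ?wA// => /andP[].
  have [->|xa] := eqVneq x a; have [->|ya] := eqVneq y a => //.
  - by move/esym/eqP; rewrite (negbTE (sep _ yA ya)).
  - by move/eqP; rewrite (negbTE (sep _ xA xa)).
  - by apply: finj; rewrite !inE ?xa ?ya.
have [->//|ta] := eqVneq t a.
by have [|] := fV t; rewrite !inE ?ta ?tA// => /andP[].
Qed.

End Hall.

(** * Doubly stochastic matrices and Birkhoff's theorem *)

Section Convexity.
Context {R : realType}.

Lemma convex_setP (V : normedModType R) (C : set V) : convex_set C <->
  forall x y (t : R), 0 <= t -> t <= 1 -> C x -> C y -> C (t *: x + (1 - t) *: y).
Proof.
split=> [cC x y t t0 t1 Cx Cy|cC x y t].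
  by have := cC x y (Itv01 t0 t1); rewrite !inE => /(_ Cx Cy).
by rewrite !inE => Cx Cy; apply: cC.
Qed.

Context {n : nat}.
Implicit Type B : @matrix R n n.

Definition doubly_stochastic B : Prop :=
  [/\ forall i j, 0 <= B i j, forall i, \sum_j B i j = 1 & forall j, \sum_i B i j = 1].

(** Hall's theorem for the relation [0 < B i j]: the rows in [A] have total mass [#|A|], all of it
    in the neighbouring columns, whose total mass is their number. *)
Lemma doubly_stochastic_perm B : doubly_stochastic B ->
  exists s : 'S_n, forall i, 0 < B i (s i).
Proof.
case=> B0 rB cB.
have [i0|no] := pickP (@predT (ordinal n)); last by exists 1%g => i; have := no i.
have [|f [finj fB]] :=
    @hall_in _ _ (fun i j => 0 < B i j) i0 [set: 'I_n]%SET [set: 'I_n]%SET.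
  move=> A _; set N := nbrs _ _ _; rewrite -(ler_nat R) -!sumr_const.
  under eq_bigr => i do rewrite -(rB i).
  under [leRHS]eq_bigr => j do rewrite -(cB j).
  apply: (@le_trans _ _ (\sum_(i in A) \sum_(j in N) B i j)).
    apply: ler_sum => i iA; rewrite [leRHS]big_mkcond; apply: ler_sum => j _.
    case: ifPn => // jN; rewrite leNgt; apply: contra jN => bij0.
    by rewrite !inE; apply/existsP; exists i; rewrite iA.
  rewrite exchange_big; apply: ler_sum => j _.
  by rewrite [leLHS]big_mkcond; apply: ler_sum => i _; case: ifP.
have inj : injective f by move=> x y; apply: finj.
exists (perm inj) => j; rewrite permE.
by have [] := fB j (finset.in_setT j).
Qed.

(* Birkhoff's theorem, with the convex combination of permutations absorbed into C. *)
Lemma doubly_stochastic_convex (C : set 'cV[R]_n) (y : 'cV[R]_n) B :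
  convex_set C -> (forall s : 'S_n, C (perm_mx s *m y)) ->
  doubly_stochastic B -> C (B *m y).
Proof.
move=> /convex_setP cC Cs.
(* Induction on the number of nonzero entries. *)
have [m] := ubnP #|[pred p : 'I_n * 'I_n | B p.1 p.2 != 0]|.
elim: m B => // m IH B; rewrite ltnS => Bm dsB.
have [s sB] := doubly_stochastic_perm dsB.
have [i0 _|no] := pickP (@predT (ordinal n)); last first.
  suff -> : B = perm_mx s by [].
  by apply/matrixP => i; have := no i.
(* [t] is the largest multiple of [perm_mx s] that can be subtracted from [B] with all entries
   staying nonnegative; the entry in row [k] and column [s k] becomes zero, so the support
   shrinks. *)
pose k := [arg min_(i < i0) B i (s i)]%O; pose t := B k (s k).
have tmin i : t <= B i (s i).
  by rewrite /t /k; case: arg_minP => // j _; apply.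
have t0 : 0 < t := sB k.
case: dsB => B0 rB cB.
have t1 : t <= 1.
  by rewrite -(rB k) (bigD1 (s k))//= lerDl sumr_ge0.
pose D := B - t *: perm_mx s.
have Dij i j : D i j = B i j - t * (s i == j)%:R by rewrite !mxE.
have D0 i j : 0 <= D i j.
  by rewrite Dij; case: eqVneq => [<-|_]; rewrite ?mulr1 ?mulr0 ?subr0// subr_ge0.
have rD i : \sum_j D i j = 1 - t.
  under eq_bigr do rewrite Dij.
  rewrite sumrB rB -mulr_sumr (bigD1 (s i))//= eqxx big1 ?addr0 ?mulr1// => j.
  by rewrite eq_sym => /negbTE ->.
have cD j : \sum_i D i j = 1 - t.
  under eq_bigr do rewrite Dij.
  rewrite sumrB cB -mulr_sumr (bigD1 (s^-1%g j))//= permKV eqxx big1 ?addr0 ?mulr1// => i.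
  by rewrite -(inj_eq (@perm_inj _ s)) permKV => /negbTE ->.
have BE : B = t *: perm_mx s + D by rewrite addrC subrK.
(* For [t = 1] the nonnegative matrix [D] has zero row sums, so [B] is [perm_mx s]; otherwise [D]
   divided by [1 - t] is again doubly stochastic. *)
have [t1'|tn1] := eqVneq t 1.
  suff D00 : D = 0 by rewrite BE t1' scale1r D00 addr0.
  apply/matrixP => i j; rewrite [RHS]mxE; have /eqP := rD i.
  rewrite t1' subrr psumr_eq0 // => /allP/(_ j (mem_index_enum j)) /=.
  by move=> /eqP.
have u0 : 0 < 1 - t by rewrite subr_gt0 lt_neqAle tn1.
have -> : B *m y = t *: (perm_mx s *m y) + (1 - t) *: (((1 - t)^-1 *: D) *m y).
  by rewrite -scalemxAl scalerA divff ?gt_eqF// scale1r [in LHS]BE mulmxDl -scalemxAl.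
apply: cC => //; first exact: ltW.
apply: IH; last first.
  split=> [i j|i|j].
  - by rewrite mxE mulr_ge0// invr_ge0 ltW.
  - by under eq_bigr do rewrite mxE; rewrite -mulr_sumr rD mulVf ?gt_eqF.
  - by under eq_bigr do rewrite mxE; rewrite -mulr_sumr cD mulVf ?gt_eqF.
apply: leq_trans Bm; apply: fintype.proper_card; apply/fintype.properP; split.
  apply/fintype.subsetP => -[i j]; rewrite !inE /= mxE mulf_eq0 negb_or => /andP[_].
  apply: contraNN => /eqP bij0; move: (D0 i j); rewrite Dij bij0.
  rewrite sub0r oppr_ge0 => le; rewrite oppr_eq0 eq_le le.
  by rewrite mulr_ge0// ltW.
exists (k, s k); first by rewrite inE /= gt_eqF.
by rewrite inE /= negbK mxE Dij eqxx mulr1 subrr mulr0.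
Qed.

End Convexity.

(** * The spectral theorem for real symmetric matrices *)

Section Spectral.
Context {R : realType}.

Lemma row_norm_gt0 n (w : 'rV[R]_n) : w != 0 -> 0 < (w *m w^T) 0 0.
Proof.
move=> w0; rewrite mxE lt0r sumr_ge0 ?andbT => [|i _]; last first.
  by rewrite mxE -expr2 sqr_ge0.
apply: contra w0; rewrite psumr_eq0 => [/allP h|i _]; last first.
  by rewrite mxE -expr2 sqr_ge0.
apply/eqP/rowP => i; have := h i (mem_index_enum i).
by rewrite /= !mxE -expr2 sqrf_eq0 => /eqP.
Qed.

(* The Householder reflection exchanging the first basis vector and v. *)
Lemma reflection_to_unit n (v : 'rV[R]_n.+1) : v *m v^T = 1%:M ->
  exists H : 'M[R]_n.+1, [/\ H^T = H, H *m H = 1%:M & delta_mx 0 0 *m H = v].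
Proof.
move=> v1; pose e : 'rV[R]_n.+1 := delta_mx 0 0; pose w := v - e.
have [/eqP|w0] := eqVneq w 0.
  by rewrite subr_eq0 => /eqP ->; exists 1%:M; rewrite trmx1 !mulmx1.
pose c := (w *m w^T) 0 0; have c0 : 0 < c := row_norm_gt0 w0.
have wwT : w *m w^T = c%:M by rewrite [LHS]mx11_scalar.
pose W := w^T *m w.
have WW : W *m W = c *: W.
  by rewrite /W mulmxA -(mulmxA w^T) wwT mul_mx_scalar -scalemxAl.
have WT : W^T = W by rewrite trmx_mul trmxK.
have ve : v *m e^T = (v 0 0)%:M.
  by rewrite [LHS]mx11_scalar /e trmx_delta -colE mxE.
have ev : e *m v^T = (v 0 0)%:M.
  by rewrite -[LHS]trmxK trmx_mul trmxK ve tr_scalar_mx.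
have ee : e *m e^T = 1%:M.
  by rewrite /e trmx_delta mul_delta_mx [LHS]mx11_scalar mxE !eqxx.
(* Both [v] and [e] are unit vectors; this value of the squared length of [w] is what makes the
   reflection along [w] send [e] to [v]. *)
have cE : c = 2 * (1 - v 0 0).
  rewrite /c /w linearB /= mulmxBl !mulmxBr v1 ve ev ee !mxE eqxx /= !mulr1n.
  ring.
exists (1%:M - (2 / c) *: W); split.
- by rewrite linearB /= trmx1 linearZ /= WT.
- rewrite mulmxBl mul1mx mulmxBr mulmx1 -scalemxAl -scalemxAr WW !scalerA.
  have -> : 2 / c * (2 / c) * c = 2 / c + 2 / c by field; rewrite gt_eqF.
  by rewrite scalerDl opprB addrK subrK.
- rewrite mulmxBr mulmx1 -scalemxAr mulmxA -/e.
  have -> : e *m w^T = (v 0 0 - 1)%:M.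
    by rewrite /w linearB /= mulmxBr ev ee raddfB.
  rewrite mul_scalar_mx scalerA.
  have -> : 2 / c * (v 0 0 - 1) = -1.
    rewrite -opprB mulrN mulrAC -cE divff ?gt_eqF//.
  by rewrite scaleN1r opprK addrC subrK.
Qed.

(** The characteristic polynomial splits over the reals, so any of its roots has a real eigenvector,
    which is then normalised. *)
Lemma symmetric_eigenvector n (Y : 'M[R]_n.+1) : Y^T = Y ->
  exists (a : R) (v : 'rV_n.+1), v *m Y = a *: v /\ v *m v^T = 1%:M.
Proof.
move=> /char_poly_sym_split[s ps].
have := size_char_poly Y; rewrite ps size_prod_XsubC => -[].
case: s ps => // a s ps _.
have /eigenvalueP[v vY v0] : eigenvalue Y a.
  by rewrite eigenvalue_root_char ps root_prod_XsubC mem_head.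
have c0 := row_norm_gt0 v0; set c := (v *m v^T) 0 0 in c0.
exists a, ((Num.sqrt c)^-1 *: v); split.
  by rewrite -scalemxAl vY !scalerA mulrC.
rewrite linearZ /= -scalemxAl -scalemxAr scalerA [v *m _]mx11_scalar -/c.
rewrite -invfM -expr2 sqr_sqrtr ?ltW// scale_scalar_mx mulVf ?gt_eqF//.
Qed.

(** Deflation: conjugating by a reflection that takes the first basis vector to a unit eigenvector
    clears the first row off the diagonal, and by symmetry the first column. The remaining block is
    symmetric and is diagonalised by induction. *)
Lemma spectral_symmetric n (Y : 'M[R]_n) : Y^T = Y ->
  exists (Q : 'M[R]_n) (d : 'rV[R]_n),
    Q^T *m Q = 1%:M /\ Y = Q *m diag_mx d *m Q^T.
Proof.
elim: n Y => [|n IH] Y symY.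
  by exists 1%:M, 0; split; apply/matrixP => -[].
have [a [v [vY /reflection_to_unit[H [HT HH eH]]]]] := symmetric_eigenvector symY.
pose Z : 'M[R]_(1 + n) := H *m Y *m H.
have ZT : Z^T = Z by rewrite !trmx_mul HT symY mulmxA.
have rZ : row 0 Z = a *: delta_mx 0 0.
  by rewrite rowE !mulmxA eH vY -scalemxAl -eH -mulmxA HH mulmx1.
have rZj j : Z 0 j = a * (0 == j)%:R.
  by have /rowP/(_ j) := rZ; rewrite !mxE eqxx eq_sym.
have YE : Y = H *m Z *m H by rewrite /Z !mulmxA HH mul1mx -mulmxA HH mulmx1.
clearbody Z.
have ZE : Z = block_mx a%:M 0 0 (drsubmx Z).
  have l0 : lshift n (0 : 'I_1) = 0 :> 'I_n.+1 by exact/val_inj.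
  have r0 (j : 'I_n) : ((0 : 'I_n.+1) == rshift 1 j) = false by [].
  rewrite -[LHS]submxK; congr block_mx; apply/matrixP => i j.
  - by rewrite !ord1 !mxE l0 rZj mulr1.
  - by rewrite !ord1 !mxE l0 rZj r0 mulr0.
  - by rewrite !ord1 !mxE l0 -ZT mxE rZj r0 mulr0.
have [|Q [d [QQ dE]]] := IH (drsubmx Z).
  by rewrite -[in RHS]ZT trmx_drsub.
pose P : 'M[R]_(1 + n) := block_mx 1%:M 0 0 Q.
have PT : P^T = block_mx 1%:M 0 0 Q^T by rewrite tr_block_mx !trmx0 trmx1.
have PP : P^T *m P = 1%:M.
  rewrite PT mulmx_block QQ !mulmx0 !mul0mx !mulmx1 !addr0 add0r.
  by rewrite -scalar_mx_block.
have ZP : Z = P *m diag_mx (row_mx a%:M d) *m P^T.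
  rewrite ZE dE PT diag_mx_row.
  have -> : diag_mx a%:M = a%:M :> 'M[R]_1.
    by apply/matrixP => i j; rewrite !ord1 !mxE.
  rewrite !mulmx_block !mulmx0 !mul0mx !addr0 ?add0r.
  by rewrite mul1mx mulmx1 !mul0mx.
exists (H *m P), (row_mx a%:M d); split.
  by rewrite trmx_mul HT -mulmxA (mulmxA H) HH mul1mx.
by rewrite YE ZP trmx_mul HT !mulmxA.
Qed.

End Spectral.

(** * Orthogonal conjugation and the bijection between symmetric sets *)

Section SymmetricSets.
Context {R : realType} {n : nat}.
Implicit Types (Q U Y A : 'M[R]_n) (y : 'cV[R]_n) (E : set 'M[R]_n) (e : set 'cV[R]_n).

Lemma orthogonal_trmx Q : orthogonal_mx Q -> orthogonal_mx Q^T.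
Proof. by move=> QQ; rewrite /orthogonal_mx /= trmxK; apply: mulmx1C. Qed.

Lemma orthogonal_mul Q U :
  orthogonal_mx Q -> orthogonal_mx U -> orthogonal_mx (Q *m U).
Proof.
move=> QQ UU; rewrite /orthogonal_mx /= trmx_mul -mulmxA (mulmxA Q^T) QQ.
by rewrite mul1mx.
Qed.

Lemma orthogonal_perm (s : 'S_n) : orthogonal_mx (perm_mx s : 'M[R]_n).
Proof. by rewrite /orthogonal_mx /= tr_perm_mx -perm_mxM mulVg perm_mx1. Qed.

Lemma orthogonal1 : orthogonal_mx (1%:M : 'M[R]_n).
Proof. by rewrite /orthogonal_mx /= trmx1 mulmx1. Qed.

Lemma conj_orthogonalK Q Y : orthogonal_mx Q -> Q *m (Q^T *m Y *m Q) *m Q^T = Y.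
Proof.
move=> /mulmx1C QQ; rewrite !mulmxA QQ mul1mx -mulmxA QQ.
by rewrite mulmx1.
Qed.

Lemma conj_orthogonal_trK Q Y : orthogonal_mx Q -> Q^T *m (Q *m Y *m Q^T) *m Q = Y.
Proof. by move=> /orthogonal_trmx/conj_orthogonalK; rewrite trmxK. Qed.

(** Stability gives one inclusion; stability under the inverse permutation gives the other. *)
Lemma symmetric_cV_setP e : symmetric_cV_set e <->
  forall (s : 'S_n) y, e y -> e (perm_mx s *m y).
Proof.
split=> [he s y ey|he P /is_perm_mxP[s ->]].
  by rewrite (he _ (perm_mx_is_perm _ s)); exists y.
apply/seteqP; split=> [y ey|_ [y ey <-]]; last exact: he.
exists (perm_mx s^-1 *m y); first exact: he.
by rewrite mulmxA -perm_mxM mulgV perm_mx1 mul1mx.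
Qed.

(** The transpose of an orthogonal matrix is orthogonal, so the conjugation can be turned around to
    the form used in [Phi_inv]. *)
Lemma symmetric_mx_setP E : symmetric_mx_set E <->
  (forall Y, E Y -> Y^T = Y) /\
  forall Q Y, orthogonal_mx Q -> E Y -> E (Q *m Y *m Q^T).
Proof.
split=> [[ES hE]|[ES hE]].
  split=> [Y /ES//|Q Y /orthogonal_trmx QQ EY].
  by rewrite (hE _ QQ); exists Y => //; rewrite trmxK.
split=> [Y /ES//|Q QQ].
apply/seteqP; split=> [Y EY|_ [Y EY <-]].
  exists (Q *m Y *m Q^T); first exact: hE.
  exact: conj_orthogonal_trK.
by have := hE _ _ (orthogonal_trmx QQ) EY; rewrite trmxK.
Qed.

Lemma diag_mx_perm (s : 'S_n) y :
  diag_mx (perm_mx s *m y)^T = perm_mx s *m diag_mx y^T *m (perm_mx s)^T.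
Proof.
rewrite tr_perm_mx -col_permE -!row_permE; apply/matrixP => i j.
by rewrite !mxE (inj_eq perm_inj).
Qed.

Lemma char_poly_conj Q A : orthogonal_mx Q ->
  char_poly (Q *m A *m Q^T) = char_poly A.
Proof.
move=> /mulmx1C QQ; rewrite /char_poly /char_poly_mx.
have -> : 'X%:M - map_mx polyC (Q *m A *m Q^T) =
    map_mx polyC Q *m ('X%:M - map_mx polyC A) *m map_mx polyC Q^T.
  rewrite mulmxBr mulmxBl -!map_mxM; congr (_ - _).
  by rewrite mul_mx_scalar -scalemxAl -map_mxM QQ map_mx1 scalemx1.
by rewrite !det_mulmx mulrAC -det_mulmx -map_mxM QQ map_mx1 det1 mul1r.
Qed.

Lemma symmetric_diag Y : Y^T = Y ->
  exists Q y, orthogonal_mx Q /\ Y = Q *m diag_mx y^T *m Q^T.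
Proof.
move=> /spectral_symmetric[Q [d [QQ YE]]].
by exists Q, d^T; rewrite trmxK.
Qed.

Lemma conj_diag_sym Q y : (Q *m diag_mx y^T *m Q^T)^T = Q *m diag_mx y^T *m Q^T.
Proof. by rewrite !trmx_mul trmxK tr_diag_mx mulmxA. Qed.

(** Conjugation preserves the characteristic polynomial, so the sorted eigenvalues and the entries
    of [y] are two lists of roots of one split polynomial. *)
Lemma lambda_bar_diag Q y : orthogonal_mx Q ->
  exists s : 'S_n, lambda_bar (Q *m diag_mx y^T *m Q^T) = perm_mx s *m y.
Proof.
move=> QQ; set Y := _ *m _ *m _.
have [_ szY] := eigenvalue_seqP (conj_diag_sym Q y : sym_mx Y).
rewrite char_poly_conj// char_poly_trig ?diag_mx_is_trig//.
have -> : \prod_(i < n) ('X - (diag_mx y^T i i)%:P) =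
    \prod_(a <- [tuple y i 0 | i < n]) ('X - a%:P).
  rewrite /= big_map big_enum /=; apply: eq_bigr => i _.
  by rewrite !mxE eqxx mulr1n.
move/esym/prod_XsubC_eq/tuple_permP => [s sE].
exists s; apply/matrixP => i j; rewrite ord1 -row_permE !mxE sE.
by rewrite (nth_map i) ?size_enum_ord// nth_ord_enum tnth_mktuple.
Qed.

Lemma Phi_inv_sym e Y : Phi_inv e Y -> Y^T = Y.
Proof. by move=> [Q QQ [y ey <-]]; apply: conj_diag_sym. Qed.

(** Two diagonalisations of one matrix both permute its [lambda_bar], so they differ by a
    permutation, which [e] absorbs. *)
Lemma mem_Phi_inv e Q y : symmetric_cV_set e -> orthogonal_mx Q ->
  Phi_inv e (Q *m diag_mx y^T *m Q^T) <-> e y.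
Proof.
move=> /symmetric_cV_setP he QQ; split=> [[U UU [u eu uE]]|ey]; last first.
  by exists Q => //; exists y.
have [s ys] := lambda_bar_diag y QQ; have [t ut] := lambda_bar_diag u UU.
move: ut; rewrite uE ys => /(congr1 (mulmx (perm_mx s^-1))).
rewrite !mulmxA -!perm_mxM mulVg perm_mx1 mul1mx => ->.
exact: he.
Qed.

Lemma Phi_inv_symmetric e : symmetric_mx_set (Phi_inv e).
Proof.
apply/symmetric_mx_setP; split=> [Y|Q _ QQ [U UU [u eu <-]]].
  exact: Phi_inv_sym.
exists (Q *m U); first exact: orthogonal_mul.
by exists u; rewrite // trmx_mul !mulmxA.
Qed.

Lemma Phi_inv_conj e Q Y :
  orthogonal_mx Q -> Phi_inv e Y -> Phi_inv e (Q^T *m Y *m Q).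
Proof.
have [_ h] := iffLR (symmetric_mx_setP _) (Phi_inv_symmetric e).
by move=> /orthogonal_trmx QQ /(h _ _ QQ); rewrite trmxK.
Qed.

(** Permutation matrices are orthogonal, so a symmetric [E] contains [Y] together with every
    diagonal form of [Y], in any order of the eigenvalues. *)
Lemma mem_Phi E y : symmetric_mx_set E -> Phi E y <-> E (diag_mx y^T).
Proof.
move=> /symmetric_mx_setP[ES hE]; split=> [[P /is_perm_mxP[s ->] [Y EY <-]]|Ey].
  have [Q [u [QQ YE]]] := symmetric_diag (ES _ EY).
  have [t tE] := lambda_bar_diag u QQ.
  rewrite YE tE !diag_mx_perm.
  apply: (hE); first exact: orthogonal_perm.
  apply: (hE); first exact: orthogonal_perm.
  rewrite -(conj_orthogonal_trK (diag_mx _) QQ) -YE -[X in _ *m X]trmxK.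
  by apply: hE => //; apply: orthogonal_trmx.
have [s sE] := lambda_bar_diag y orthogonal1.
exists (perm_mx s^-1); first exact: perm_mx_is_perm.
exists (diag_mx y^T) => //; move: sE; rewrite trmx1 mul1mx mulmx1 => ->.
by rewrite mulmxA -perm_mxM mulVg perm_mx1 mul1mx.
Qed.

Lemma Phi_symmetric E : symmetric_mx_set E -> symmetric_cV_set (Phi E).
Proof.
move=> hE; apply/symmetric_cV_setP => s y; rewrite !mem_Phi// diag_mx_perm.
by case/symmetric_mx_setP: hE => _; apply; apply: orthogonal_perm.
Qed.

Lemma Phi_invK e : symmetric_cV_set e -> Phi (Phi_inv e) = e.
Proof.
move=> he; apply/seteqP; split=> y; rewrite mem_Phi; try exact: Phi_inv_symmetric.
all: rewrite -[diag_mx _]mul1mx -[_ *m _]mulmx1 -[X in _ *m X]trmx1.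
all: by rewrite mem_Phi_inv//; apply: orthogonal1.
Qed.

Lemma PhiK E : symmetric_mx_set E -> Phi_inv (Phi E) = E.
Proof.
move=> hE; have [ES EQ] := iffLR (symmetric_mx_setP E) hE.
apply/seteqP; split=> [_ [Q QQ [y + <-]]|Y EY].
  by rewrite mem_Phi// => ?; apply: EQ.
have [Q [y [QQ YE]]] := symmetric_diag (ES _ EY).
exists Q => //; exists y => //; rewrite mem_Phi//.
rewrite -(conj_orthogonal_trK (diag_mx _) QQ) -YE -[X in _ *m X]trmxK.
by apply: (EQ) => //; apply: orthogonal_trmx.
Qed.

End SymmetricSets.

(** * Minkowski combinations and extreme points in a normed space *)

Section MinkowskiCombination.
Context {R : realType} {V : normedModType R}.
Implicit Types (A B K : set V) (a b : R).

Lemma minkowski_combE A B a b x :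
  (a [*] A [+] b [*] B) x <-> exists u v, [/\ A u, B v & x = a *: u + b *: v].
Proof.
split=> [[_ [u Au <-] [_ [v Bv <-] <-]]|[u [v [Au Bv ->]]]]; first by exists u, v.
by exists (a *: u); [exists u|exists (b *: v); [exists v|]].
Qed.

Lemma minkowski_comb_convex A B a b :
  convex_set A -> convex_set B -> convex_set (a [*] A [+] b [*] B).
Proof.
move=> /convex_setP cA /convex_setP cB; apply/convex_setP => x y t t0 t1.
move=> /minkowski_combE[u [v [Au Bv ->]]] /minkowski_combE[u' [v' [Au' Bv' ->]]].
apply/minkowski_combE; exists (t *: u + (1 - t) *: u'), (t *: v + (1 - t) *: v').
split; [exact: cA|exact: cB|].
rewrite !scalerDr !scalerA addrACA.
by rewrite ![t * _]mulrC ![(1 - t) * _]mulrC.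
Qed.

Lemma minkowski_comb_compact A B a b :
  compact A -> compact B -> compact (a [*] A [+] b [*] B).
Proof.
move=> cA cB.
have -> : a [*] A [+] b [*] B = (fun p : V * V => a *: p.1 + b *: p.2) @` (A `*` B).
  apply/seteqP; split=> x => [/minkowski_combE[u [v [Au Bv ->]]]|[[u v] /= [Au Bv] <-]].
    by exists (u, v).
  by apply/minkowski_combE; exists u, v.
apply: continuous_compact; last exact: compact_setX.
apply: continuous_subspaceT => p.
by apply: cvgD; apply: cvgZr; [exact: cvg_fst|exact: cvg_snd].
Qed.

Lemma minkowski_comb_convex_body A B a b :
  convex_body A -> convex_body B -> convex_body (a [*] A [+] b [*] B).
Proof.
case=> -[x Ax] cA kA [[y By] cB kB]; split.
- by exists (a *: x + b *: y); apply/minkowski_combE; exists x, y.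
- exact: minkowski_comb_convex.
- exact: minkowski_comb_compact.
Qed.

(** Deleting [x] destroys convexity exactly when [x] is a combination of two points of [K] other
    than [x]. The conclusion is a disjunction because [t] may be 0 or 1, which leaves one of the two
    points arbitrary. *)
Lemma extreme_pointsP K x : convex_set K -> extreme_points K x <->
  K x /\ forall u v t, 0 <= t -> t <= 1 -> K u -> K v ->
    t *: u + (1 - t) *: v = x -> u = x \/ v = x.
Proof.
move=> /convex_setP cK; split=> -[Kx cx]; split=> //.
  move=> u v t t0 t1 Ku Kv uv; have [->|/eqP ux] := eqVneq u x; first by left.
  have [->|/eqP vx] := eqVneq v x; first by right.
  move/convex_setP: cx => /(_ u v t t0 t1 (conj Ku ux) (conj Kv vx))[_] /=.
  by rewrite uv.
apply/convex_setP => u v t t0 t1 [Ku ux] [Kv vx]; split; first exact: cK.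
by move=> /= /cx[] //.
Qed.

(** The inverse [g] pulls a combination equal to [f x] back to one equal to [x]. *)
Lemma extreme_points_linear K (f g : {linear V -> V}) x :
  convex_set K -> cancel f g -> cancel g f ->
  (forall u, K u -> K (f u)) -> (forall u, K u -> K (g u)) ->
  extreme_points K x -> extreme_points K (f x).
Proof.
move=> cK fK gK Kf Kg /(extreme_pointsP _ cK)[Kx ex].
apply/(extreme_pointsP _ cK); split=> [|u v t t0 t1 Ku Kv /(congr1 g)]; first exact: Kf.
rewrite fK linearD !linearZ /= => /ex[] //; [exact: Kg|exact: Kg| |] => <-.
  by left; rewrite gK.
by right; rewrite gK.
Qed.

End MinkowskiCombination.

(** * Schur's theorem, convex combinations and extreme points of spectral sets *)

Section SchurHorn.
Context {R : realType} {n : nat}.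
Implicit Types (Q Y A : 'M[R]_n) (y : 'cV[R]_n) (K E : set 'M[R]_n) (k e : set 'cV[R]_n).

Definition diagonal_col Y : 'cV[R]_n := \col_i Y i i.

Lemma diagonal_colD a b A Y :
  diagonal_col (a *: A + b *: Y) = a *: diagonal_col A + b *: diagonal_col Y.
Proof. by apply/colP => i; rewrite !mxE. Qed.

Lemma diagonal_col_diag y : diagonal_col (diag_mx y^T) = y.
Proof. by apply/colP => i; rewrite !mxE eqxx mulr1n. Qed.

Lemma diag_mx_trD a b y z :
  diag_mx (a *: y + b *: z : 'cV[R]_n)^T = a *: diag_mx y^T + b *: diag_mx z^T.
Proof. by rewrite !linearD /= !linearZ /=. Qed.

(** For orthogonal [Q] this is the associated orthostochastic matrix. *)
Definition sqr_entries Q : 'M[R]_n := \matrix_(i, j) (Q i j ^+ 2).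

Lemma sqr_entries_doubly_stochastic Q :
  orthogonal_mx Q -> doubly_stochastic (sqr_entries Q).
Proof.
have row1 (U : 'M[R]_n) : orthogonal_mx U^T -> forall i, \sum_j U i j ^+ 2 = 1.
  rewrite /orthogonal_mx /= trmxK => UU i; move/matrixP/(_ i i): UU.
  rewrite !mxE eqxx => UUi; apply: etrans UUi; apply: eq_bigr => j _.
  by rewrite mxE.
move=> QQ; split=> [i j|i|j].
- by rewrite mxE sqr_ge0.
- by under eq_bigr do rewrite mxE; apply: row1; apply: orthogonal_trmx.
- under eq_bigr do rewrite mxE; rewrite -(row1 Q^T _ j) ?trmxK//.
  by apply: eq_bigr => i _; rewrite mxE.
Qed.

Lemma diagonal_col_conj Q y :
  diagonal_col (Q *m diag_mx y^T *m Q^T) = sqr_entries Q *m y.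
Proof.
apply/colP => i; rewrite mul_mx_diag !mxE; apply: eq_bigr => j _.
by rewrite !mxE mulrAC.
Qed.

(* Schur: the diagonal of a symmetric matrix is a doubly stochastic image of its spectrum. *)
Lemma diagonal_col_mem e Y : symmetric_cV_set e -> convex_set e ->
  Phi_inv e Y -> e (diagonal_col Y).
Proof.
move=> /symmetric_cV_setP he ce [Q QQ [y ey <-]]; rewrite diagonal_col_conj.
apply: doubly_stochastic_convex => // [s|]; first exact: he.
exact: sqr_entries_doubly_stochastic.
Qed.

(** [A] and [Y] need not be simultaneously diagonalisable. In an eigenbasis of the combination only
    their diagonals matter, and Schur's theorem puts these in [e] and [e']. *)
Lemma Phi_inv_comb e e' A Y a b :
  symmetric_cV_set e -> convex_set e -> symmetric_cV_set e' -> convex_set e' ->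
  Phi_inv e A -> Phi_inv e' Y ->
  exists Q u v, [/\ orthogonal_mx Q, e u, e' v &
    a *: A + b *: Y = Q *m diag_mx (a *: u + b *: v)^T *m Q^T].
Proof.
move=> he ce he' ce' eA eY.
have [|Q [y [QQ YE]]] := @symmetric_diag _ _ (a *: A + b *: Y).
  by rewrite linearD /= !linearZ /= (Phi_inv_sym eA) (Phi_inv_sym eY).
exists Q, (diagonal_col (Q^T *m A *m Q)), (diagonal_col (Q^T *m Y *m Q)); split => //.
- by apply: diagonal_col_mem => //; apply: Phi_inv_conj.
- by apply: diagonal_col_mem => //; apply: Phi_inv_conj.
rewrite YE; congr (_ *m diag_mx _^T *m _).
rewrite -diagonal_colD -[LHS]diagonal_col_diag -(conj_orthogonal_trK (diag_mx _) QQ) -YE.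
by rewrite mulmxDr mulmxDl -!scalemxAr -!scalemxAl.
Qed.

Lemma Phi_inv_convex e : symmetric_cV_set e -> convex_set e -> convex_set (Phi_inv e).
Proof.
move=> he ce; apply/convex_setP => A Y t t0 t1 eA eY.
have [Q [u [v [QQ eu ev ->]]]] := Phi_inv_comb t (1 - t) he ce he ce eA eY.
by exists Q => //; exists (t *: u + (1 - t) *: v); first by move/convex_setP: ce; apply.
Qed.

(** Both sides are the trace of the square of [Y], the squared Frobenius norm. *)
Lemma mxtrace_conj_diag_sqr Q y : orthogonal_mx Q ->
  let Y := Q *m diag_mx y^T *m Q^T in
  \sum_i \sum_j Y i j ^+ 2 = \sum_i y i 0 ^+ 2.
Proof.
move=> QQ Y; have YT i j : Y j i = Y i j.
  by have /matrixP/(_ i j) := conj_diag_sym Q y; rewrite mxE.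
transitivity (\tr (Y *m Y)).
  apply: eq_bigr => i _; rewrite mxE; apply: eq_bigr => j _.
  by rewrite YT.
have -> : Y *m Y = Q *m (diag_mx y^T *m diag_mx y^T) *m Q^T.
  by rewrite /Y !mulmxA -(mulmxA _ Q^T) QQ mulmx1.
rewrite mxtrace_mulC (mulmxA Q^T) QQ mul1mx mul_mx_diag.
by apply: eq_bigr => i _; rewrite !mxE eqxx mulr1n.
Qed.

(* If the diagonal y of Y is extreme, it is a permutation of the spectrum of Y, so the
   Frobenius norm leaves no room for off-diagonal entries. *)
Lemma extreme_diagonal e Y y : symmetric_cV_set e -> extreme_points e y ->
  Phi_inv e Y -> diagonal_col Y = y -> Y = diag_mx y^T.
Proof.
move=> /symmetric_cV_setP he [ey cy] [Q QQ [u eu YE]] Yy.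
(* Otherwise the convex set [e] without [y] contains all permutations of [u], hence by Birkhoff also
   the diagonal of [Y], which is [y]. *)
have [s ys] : exists s : 'S_n, perm_mx s *m u = y.
  apply: contrapT => nos.
  have : (e `\ y) (sqr_entries Q *m u).
    apply: doubly_stochastic_convex => // [s|].
      by split; [exact: he|move=> su; apply: nos; exists s].
    exact: sqr_entries_doubly_stochastic.
  by case=> _; rewrite -diagonal_col_conj YE Yy; apply.
(* The sum of the squared off-diagonal entries: the Frobenius norm comes from [u], the diagonal part
   from its permutation [y]. *)
have sumE : \sum_i (\sum_j Y i j ^+ 2 - Y i i ^+ 2) = 0.
  rewrite sumrB -YE mxtrace_conj_diag_sqr// YE.
  apply/eqP; rewrite subr_eq0; apply/eqP.
  rewrite (reindex_inj (@perm_inj _ s)); apply: eq_bigr => i _.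
  by move/colP/(_ i): Yy; rewrite -ys -row_permE !mxE => ->.
have tail i : \sum_j Y i j ^+ 2 - Y i i ^+ 2 = \sum_(j | j != i) Y i j ^+ 2.
  by rewrite (bigD1 i)//= addrAC subrr add0r.
apply/matrixP => i j; rewrite -Yy !mxE.
have [<-|ij] := eqVneq i j; first by rewrite mulr1n.
move/eqP: sumE; rewrite psumr_eq0 => [/allP/(_ i (mem_index_enum i)) /=|l _]; last first.
  by rewrite tail sumr_ge0// => m _; rewrite sqr_ge0.
rewrite tail psumr_eq0 => [/allP/(_ j (mem_index_enum j)) /=|m _]; last first.
  by rewrite sqr_ge0.
by rewrite eq_sym ij sqrf_eq0 => /eqP.
Qed.

Lemma extreme_points_cV_symmetric e : symmetric_cV_set e -> convex_set e ->
  symmetric_cV_set (extreme_points e).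
Proof.
move=> /symmetric_cV_setP he ce; apply/symmetric_cV_setP => s y.
have permK (t : 'S_n) : cancel (mulmx (perm_mx t : 'M[R]_n) : 'cV_n -> 'cV_n)
    (mulmx (perm_mx t^-1)).
  by move=> z; rewrite mulmxA -perm_mxM mulVg perm_mx1 mul1mx.
apply: (@extreme_points_linear _ _ e (mulmx (perm_mx s)) (mulmx (perm_mx s^-1))) => //.
- exact: permK.
- by have := permK (s^-1)%g; rewrite invgK.
- by move=> u; apply: he.
- by move=> u; apply: he.
Qed.

(** From left to right, a combination of vectors becomes one of matrices diagonal in the same basis
    [Q]. Conversely, the diagonals of [A] and [B] in the basis [Q] combine to the extreme point [y],
    so one of them equals [y], and [extreme_diagonal] recovers the whole matrix. *)
Lemma extreme_points_Phi_inv e : symmetric_cV_set e -> convex_set e ->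
  extreme_points (Phi_inv e) = Phi_inv (extreme_points e).
Proof.
move=> he ce; have cP := Phi_inv_convex he ce.
have hext := extreme_points_cV_symmetric he ce.
apply/seteqP; split=> X.
  move=> /(extreme_pointsP _ cP)[[Q QQ [y ey <-]] ex].
  exists Q => //; exists y => //; apply/(extreme_pointsP _ ce); split=> //.
  move=> u v t t0 t1 eu ev uv.
  have inj w z : Q *m diag_mx w^T *m Q^T = Q *m diag_mx z^T *m Q^T -> w = z.
    move=> /(congr1 (fun Z => diagonal_col (Q^T *m Z *m Q))).
    by rewrite !conj_orthogonal_trK// !diagonal_col_diag.
  have [|||/inj|/inj] := ex (Q *m diag_mx u^T *m Q^T) (Q *m diag_mx v^T *m Q^T) t t0 t1.
  - by exists Q => //; exists u.
  - by exists Q => //; exists v.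
  - by rewrite -uv diag_mx_trD mulmxDr mulmxDl -!scalemxAr -!scalemxAl.
  - by left.
  - by right.
case=> Q QQ [y eey <-]; have [ey ex] := iffLR (extreme_pointsP _ ce) eey.
apply/(extreme_pointsP _ cP); split; first by exists Q => //; exists y.
move=> A B t t0 t1 eA eB AB.
have back Z : Phi_inv e Z -> diagonal_col (Q^T *m Z *m Q) = y ->
    Z = Q *m diag_mx y^T *m Q^T.
  move=> eZ Zy; rewrite -(extreme_diagonal he eey (Phi_inv_conj QQ eZ) Zy).
  by rewrite conj_orthogonalK.
have [|||/(back _ eA)|/(back _ eB)] :=
    ex (diagonal_col (Q^T *m A *m Q)) (diagonal_col (Q^T *m B *m Q)) t t0 t1.
- by apply: diagonal_col_mem => //; apply: Phi_inv_conj.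
- by apply: diagonal_col_mem => //; apply: Phi_inv_conj.
- transitivity (diagonal_col (Q^T *m (t *: A + (1 - t) *: B) *m Q)).
    by rewrite mulmxDr mulmxDl -!scalemxAr -!scalemxAl diagonal_colD.
  by rewrite AB conj_orthogonal_trK// diagonal_col_diag.
- by left.
- by right.
Qed.

End SchurHorn.

(** * Symmetry of combinations and compatibility with the bijection *)

Section Transport.
Context {R : realType} {n : nat}.
Implicit Types (E K : set 'M[R]_n) (e k : set 'cV[R]_n) (a b : R).

Lemma minkowski_comb_cV_symmetric e e' a b : symmetric_cV_set e ->
  symmetric_cV_set e' -> symmetric_cV_set (a [*] e [+] b [*] e').
Proof.
move=> /symmetric_cV_setP he /symmetric_cV_setP he'; apply/symmetric_cV_setP => s y.
move=> /minkowski_combE[u [v [eu ev ->]]]; apply/minkowski_combE.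
exists (perm_mx s *m u), (perm_mx s *m v); split; [exact: he|exact: he'|].
by rewrite mulmxDr -!scalemxAr.
Qed.

Lemma minkowski_comb_mx_symmetric E E' a b : symmetric_mx_set E ->
  symmetric_mx_set E' -> symmetric_mx_set (a [*] E [+] b [*] E').
Proof.
move=> /symmetric_mx_setP[ES hE] /symmetric_mx_setP[ES' hE'].
apply/symmetric_mx_setP; split=> [Y|Q Y QQ] /minkowski_combE[A [B [EA EB ->]]].
  by rewrite linearD /= !linearZ /= (ES _ EA) (ES' _ EB).
apply/minkowski_combE; exists (Q *m A *m Q^T), (Q *m B *m Q^T).
split; [exact: hE|exact: hE'|].
by rewrite mulmxDr mulmxDl -!scalemxAr -!scalemxAl.
Qed.

Lemma ones_symmetric : symmetric_cV_set [set const_mx 1 : 'cV[R]_n].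
Proof.
apply/symmetric_cV_setP => s _ ->; rewrite -row_permE /=.
by apply/matrixP => i j; rewrite !mxE.
Qed.

(** One inclusion uses a common eigenbasis for both summands; the other is [Phi_inv_comb], where
    Schur's theorem enters. *)
Lemma Phi_inv_minkowski_comb e e' a b :
  symmetric_cV_set e -> convex_set e -> symmetric_cV_set e' -> convex_set e' ->
  Phi_inv (a [*] e [+] b [*] e') = a [*] Phi_inv e [+] b [*] Phi_inv e'.
Proof.
move=> he ce he' ce'; apply/seteqP; split=> Y.
  move=> [Q QQ [_ /minkowski_combE[u [v [eu ev ->]]] <-]]; apply/minkowski_combE.
  exists (Q *m diag_mx u^T *m Q^T), (Q *m diag_mx v^T *m Q^T); split.
  - by exists Q => //; exists u.
  - by exists Q => //; exists v.
  - by rewrite diag_mx_trD mulmxDr mulmxDl -!scalemxAr -!scalemxAl.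
move=> /minkowski_combE[A [B [eA eB ->]]].
have [Q [u [v [QQ eu ev ->]]]] := Phi_inv_comb a b he ce he' ce' eA eB.
exists Q => //; exists (a *: u + b *: v) => //.
by apply/minkowski_combE; exists u, v.
Qed.

(** Conjugation fixes the identity, so a diagonalisation of the second summand diagonalises the
    sum. *)
Lemma Phi_inv_minkowski_ones e a b :
  Phi_inv (a [*] [set const_mx 1] [+] b [*] e) = a [*] [set 1%:M] [+] b [*] Phi_inv e.
Proof.
have conjE Q (u : 'cV[R]_n) : orthogonal_mx Q ->
    Q *m diag_mx (a *: const_mx 1 + b *: u)^T *m Q^T =
    a *: 1%:M + b *: (Q *m diag_mx u^T *m Q^T).
  move=> /mulmx1C QQ; rewrite diag_mx_trD mulmxDr mulmxDl -!scalemxAr -!scalemxAl.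
  by rewrite trmx_const diag_const_mx mulmx1 QQ.
apply/seteqP; split=> Y.
  move=> [Q QQ [_ /minkowski_combE[_ [u [-> eu ->]]] <-]]; apply/minkowski_combE.
  exists 1%:M, (Q *m diag_mx u^T *m Q^T); split => //; last exact: conjE.
  by exists Q => //; exists u.
move=> /minkowski_combE[_ [_ [-> [Q QQ [u eu <-]] ->]]].
exists Q => //; exists (a *: const_mx 1 + b *: u); last exact: conjE.
by apply/minkowski_combE; exists (const_mx 1), u.
Qed.

(** By [mem_Phi] the set is the preimage of [E] under the linear map from vectors to diagonal
    matrices. *)
Lemma Phi_convex E : symmetric_mx_set E -> convex_set E -> convex_set (Phi E).
Proof.
move=> hE /convex_setP cE; apply/convex_setP => x y t t0 t1.
by rewrite !mem_Phi// diag_mx_trD; apply: cE.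
Qed.

Lemma Phi_inv_mono e e' : e' `<=` e -> Phi_inv e' `<=` Phi_inv e.
Proof. by move=> ee _ [Q QQ [y /ee ey <-]]; exists Q => //; exists y. Qed.

Lemma Phi_mono E E' : E' `<=` E -> Phi E' `<=` Phi E.
Proof. by move=> EE _ [P PP [Y /EE EY <-]]; exists P => //; exists Y. Qed.

End Transport.

Theorem theorem3p1p2 (R : realType) (n : nat) (hn : (2 <= n)%N) :
  (forall (E E' K K' : set 'M[R]_n) (alpha beta : R),
    symmetric_mx_set E -> symmetric_mx_set E' ->
    symmetric_mx_set K -> convex_body K ->
    symmetric_mx_set K' -> convex_body K' ->
    [/\ symmetric_mx_set (extreme_points K),
        extreme_points (Phi K) = Phi (extreme_points K),
        symmetric_mx_set (alpha [*] E [+] beta [*] E') /\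
        (symmetric_mx_set (alpha [*] K [+] beta [*] K') /\
         convex_body (alpha [*] K [+] beta [*] K')),
        Phi (alpha [*] [set 1%:M] [+] beta [*] E) =
          alpha [*] [set const_mx 1] [+] beta [*] Phi E /\
        Phi (alpha [*] K [+] beta [*] K') =
          alpha [*] Phi K [+] beta [*] Phi K' &
        E' `<=` E -> Phi E' `<=` Phi E]) /\
  (forall (e e' k k' : set 'cV[R]_n) (alpha beta : R),
    symmetric_cV_set e -> symmetric_cV_set e' ->
    symmetric_cV_set k -> convex_body k ->
    symmetric_cV_set k' -> convex_body k' ->
    [/\ symmetric_cV_set (extreme_points k),
        extreme_points (Phi_inv k) = Phi_inv (extreme_points k),
        symmetric_cV_set (alpha [*] e [+] beta [*] e') /\
        (symmetric_cV_set (alpha [*] k [+] beta [*] k') /\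
         convex_body (alpha [*] k [+] beta [*] k')),
        Phi_inv (alpha [*] [set const_mx 1] [+] beta [*] e) =
          alpha [*] [set 1%:M] [+] beta [*] Phi_inv e /\
        Phi_inv (alpha [*] k [+] beta [*] k') =
          alpha [*] Phi_inv k [+] beta [*] Phi_inv k' &
        e' `<=` e -> Phi_inv e' `<=` Phi_inv e]).
Proof.
split=> [E E' K K'|e e' k k'] a b.
  move=> hE hE' hK bK hK' bK'; have [_ cK _] := bK; have [_ cK' _] := bK'.
  have PK := Phi_symmetric hK; have cPK := Phi_convex hK cK.
  have PK' := Phi_symmetric hK'; have cPK' := Phi_convex hK' cK'.
  (* [K] is [Phi_inv (Phi K)], so the vector result for [Phi K] yields both claims on extreme points
     of [K]. *)
  have extK : extreme_points K = Phi_inv (extreme_points (Phi K)).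
    by rewrite -extreme_points_Phi_inv// PhiK.
  have PE := Phi_symmetric hE.
  split.
  - by rewrite extK; apply: Phi_inv_symmetric.
  - by rewrite extK Phi_invK//; apply: extreme_points_cV_symmetric.
  - split; first exact: minkowski_comb_mx_symmetric.
    split; first exact: minkowski_comb_mx_symmetric.
    exact: minkowski_comb_convex_body.
  - split.
      (* Writing [E] as [Phi_inv (Phi E)] turns the matrix sum into [Phi_inv] of a symmetric vector
         sum, which [Phi] then undoes. *)
      rewrite -{1}(PhiK hE) -Phi_inv_minkowski_ones Phi_invK//.
      by apply: minkowski_comb_cV_symmetric => //; apply: ones_symmetric.
    rewrite -{1}(PhiK hK) -{1}(PhiK hK') -Phi_inv_minkowski_comb// Phi_invK//.
    exact: minkowski_comb_cV_symmetric.
  - exact: Phi_mono.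
move=> he he' hk bk hk' bk'; have [_ ck _] := bk; have [_ ck' _] := bk'.
split.
- exact: extreme_points_cV_symmetric.
- exact: extreme_points_Phi_inv.
- split; first exact: minkowski_comb_cV_symmetric.
  split; first exact: minkowski_comb_cV_symmetric.
  exact: minkowski_comb_convex_body.
- split; [exact: Phi_inv_minkowski_ones|exact: Phi_inv_minkowski_comb].
- exact: Phi_inv_mono.
Qed.
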